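(* Let $d\ge 2$ and $n\ge 2$ be integers such that $n$ is odd, or $n$ is even and $d>2$. Then $$S=\mathcal A_d^n\setminus\{x\in\mathcal A_d^n : x_1=x_n\}$$ (i.e. $\mathcal A_d^n$ minus all strings $a\oplus w\oplus a$ with $a\in\mathcal A_d$, $w\in\mathcal A_d^{n-2}$) is a $1$-identifying code of $\vec{\mathcal B}(d,n)$, and it has size $(d-1)d^{n-1}$, the minimum possible size of a $1$-identifying code of $\vec{\mathcal B}(d,n)$.
   Context: $\mathcal A_d=\{0,1,\dots,d-1\}$; $\mathcal A_d^n$ is the set of strings $x=x_1\cdots x_n$ over $\mathcal A_d$; $\oplus$ is concatenation. The directed de Bruijn graph $\vec{\mathcal B}(d,n)$ has vertex set $\mathcal A_d^n$ and an arc from $x_1\cdots x_n$ to $y_1\cdots y_n$ iff $x_2\cdots x_n=y_1\cdots y_{n-1}$. $\vec d(u,v)$ is the length of a shortest directed walk from $u$ to $v$; $B_t^-(v)=\{u:\vec d(u,v)\le t\}$; for $S\subseteq V$, $\mathrm{ID}_S(v)=B_t^-(v)\cap S$; a $t$-identifying code is a set $S$ with $\mathrm{ID}_S(v)\ne\emptyset$ for all $v$ and $\mathrm{ID}_S(u)\ne\mathrm{ID}_S(v)$ for all $u\ne v$. *)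

(* Defs.v *)
From mathcomp Require Import all_boot.

Set Implicit Arguments.
Unset Strict Implicit.
Unset Printing Implicit Defensive.

Section Digraph.
Variables (T : finType) (e : rel T).

Definition has_walk (u v : T) (k : nat) : bool :=
  [exists p : k.-tuple T, path e u p && (last u p == v)].

(* The directed distance is a relation, since it is infinite when v is not
   reachable from u. *)
Definition is_ddist (u v : T) (k : nat) : bool :=
  has_walk u v k && [forall j : 'I_k, ~~ has_walk u v j].

Definition in_ball (t : nat) (v : T) : {set T} :=
  [set u | [exists k : 'I_t.+1, is_ddist u v k]].

Definition ID (t : nat) (S : {set T}) (v : T) : {set T} := in_ball t v :&: S.

Definition identifying_code (t : nat) (S : {set T}) : Prop :=
  (forall v, ID t S v != set0) /\
  (forall u v, u != v -> ID t S u != ID t S v).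

End Digraph.

Notation string d n := (n.-tuple 'I_d).

Definition debruijn (d n : nat) : rel (string d n) :=
  fun x y => drop 1 x == take n.-1 y.

Arguments debruijn d n : clear implicits.

(* Letters are numbered from 0 in sequences: for n > 0, [onth x 0] is x_1 and
   [onth x n.-1] is x_n. *)
Definition distinct_ends (d n : nat) : {set string d n} :=
  [set: string d n] :\: [set x : string d n | onth x 0 == onth x n.-1].

Arguments distinct_ends d n : clear implicits.

(* Main.v *)
Require Import Defs.
From mathcomp Require Import all_boot.

(** The ball of [w ⊕ b] consists of itself and of the strings [a ⊕ w], so two
strings that share the prefix [w] are separated by [S] only if one of them lies
in [S]. Hence the complement of a code injects into the set of prefixes, which
is the lower bound. For the set of strings with distinct ends, [b] is determined
by [w] whenever [w ⊕ b] is omitted, which separates strings with equal prefixes.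
If the prefixes [w <> w'] of [u] and [v] differ, each [a ⊕ w] in [S] belongs to
the ball of [v] only if it is [v]: this is impossible for [d > 2], as there are
[d - 1 > 1] such strings. In general it produces arcs [u -> v -> u], so that [v]
alternates between two letters and, for [n] odd, has equal ends. *)

Lemma has_walk0 (T : finType) (e : rel T) (u v : T) :
  has_walk e u v 0 = (u == v).
Proof.
apply/existsP/idP => [[p]|/eqP->]; first by rewrite (tuple0 p).
by exists [tuple]; rewrite /= eqxx.
Qed.

Lemma has_walk1 (T : finType) (e : rel T) (u v : T) : has_walk e u v 1 = e u v.
Proof.
apply/existsP/idP => [[p]|euv].
  by case/tupleP: p => x p; rewrite (tuple0 p) /= andbT => /andP[eux /eqP<-].
by exists [tuple v]; rewrite /= euv eqxx.
Qed.

Lemma in_ball1 (T : finType) (e : rel T) (u v : T) :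
  (u \in in_ball e 1 v) = (u == v) || e u v.
Proof.
rewrite inE; apply/existsP/idP => [[[[|[|k]] //= ltk]]|].
- by rewrite /is_ddist has_walk0 => /andP[->].
- by rewrite /is_ddist has_walk1 => /andP[->]; rewrite orbT.
(* At a loop there are walks of lengths 0 and 1, and the distance is 0; hence the case [u = v] is
   settled first. *)
have [-> _|neq_uv /= euv] := eqVneq u v.
  exists ord0; rewrite /is_ddist has_walk0 eqxx.
  by apply/forallP => -[].
exists ord_max; rewrite /is_ddist has_walk1 euv /=.
by apply/forallP => -[[|j] //= ltj]; rewrite has_walk0.
Qed.

Lemma in_ID1 (T : finType) (e : rel T) (S : {set T}) (u v : T) :
  (u \in ID e 1 S v) = ((u == v) || e u v) && (u \in S).
Proof. by rewrite in_setI in_ball1. Qed.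

Lemma rcons_tupleP (T : Type) (k : nat) (v : k.+1.-tuple T) :
  exists (w : k.-tuple T) (b : T), v = [tuple of rcons w b].
Proof.
case/tupleP: v => a t.
exists (belast_tuple a t), (last a t).
by apply: val_inj; rewrite /= -lastI.
Qed.

Lemma debruijn_cons_rcons (d k : nat) (a b : 'I_d) (w w' : k.-tuple 'I_d) :
  debruijn d k.+1 [tuple of a :: w] [tuple of rcons w' b] = (w == w').
Proof.
by rewrite /debruijn /= drop0 -cats1 take_size_cat ?size_tuple.
Qed.

Lemma cons_in_distinct_ends (d k : nat) (a : 'I_d) (w : k.-tuple 'I_d) :
  ([tuple of a :: w] \in distinct_ends d k.+1) = (a != last a w).
Proof.
rewrite !inE andbT; congr (~~ _).
have -> : onth [tuple of a :: w] k.+1.-1 = Some (last a w).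
  by rewrite onthE (nth_map a) ?size_tuple // (last_nth a) /= size_tuple.
by rewrite /=; apply/eqP/eqP => [[]|<-].
Qed.

Lemma distinct_endsE (d k : nat) (a : 'I_d) (x : string d k.+1) :
  (x \in distinct_ends d k.+1) = (head a x != last a x).
Proof. by case/tupleP: x => c w; rewrite cons_in_distinct_ends. Qed.

(** If nonempty, [w] begins with [a'] and [w'] with [a], and each later letter of one is the
    preceding letter of the other. So [w] reads [a'], [a], [a'], ..., and the induction exchanges
    [a] and [a']. For empty [w] the default [a] fits the even case. *)
Lemma last_alternating (T : Type) (a a' b b' : T) (w w' : seq T) :
  rcons w b = a' :: w' -> rcons w' b' = a :: w ->
  last a w = if odd (size w) then a' else a.
Proof.
elim: w a a' w' => [|x s IH] a a' w' //= [-> Ew'].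
rewrite -Ew' => /=; case: w' Ew' => [|y s'] Ew'.
  by case: (s) Ew'.
rewrite Ew' => -[ya Es'].
by rewrite (IH _ a s') // ?Ew' ?ya //; case: odd.
Qed.

Lemma card_code_lower_bound (d k : nat) (S : {set string d k.+1}) :
  identifying_code (debruijn d k.+1) 1 S -> (d - 1) * d ^ k <= #|S|.
Proof.
case=> _ sepS.
pose pre (v : string d k.+1) := belast_tuple (thead v) (behead_tuple v).
have preE (w : string d k) b : pre [tuple of rcons w b] = w.
  apply: val_inj => /=; rewrite /thead (tnth_nth b) /=.
  by case: (val w) => [|x s] //=; rewrite belast_rcons.
have inj_pre : {in ~: S &, injective pre}.
  move=> u v.
  have [w [b ->]] := rcons_tupleP _ _ u; have [w' [b' ->]] := rcons_tupleP _ _ v.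
  rewrite !preE !inE => nSu nSv eq_w; subst w'.
  apply/eqP/negPn/negP => /sepS/eqP; apply.
  apply/setP => z; case/tupleP: z => a t.
  rewrite !in_ID1 !debruijn_cons_rcons.
  have [Sz|_] := boolP (_ \in S); last by rewrite !andbF.
  (* A member of [S] is never equal to an omitted string, so only the arc test is left, and it
     depends on the common prefix alone. *)
  have neqS y : y \notin S -> ([tuple of a :: t] == y) = false.
    by move=> nSy; apply: contraNF nSy => /eqP<-.
  by rewrite (neqS _ nSu) (neqS _ nSv).
have le_compl : #|~: S| <= d ^ k.
  rewrite -(card_in_imset inj_pre) -[d in d ^ k]card_ord -card_tuple.
  exact: max_card.
rewrite mulnBl mul1n -expnS leq_subLR.
rewrite -[d in d ^ k.+1]card_ord -card_tuple -(cardsC S) addnC.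
by rewrite leq_add2r.
Qed.

(** Appending its first letter to a string of length [k.+1] is injective and yields equal ends, so
    at least [d ^ k.+1] strings are omitted. The reverse inequality will come from the lower bound
    for codes. *)
Lemma card_distinct_ends_upper_bound (d k : nat) :
  0 < d -> #|distinct_ends d k.+2| <= (d - 1) * d ^ k.+1.
Proof.
move=> d_gt0; pose close (w : string d k.+1) := [tuple of rcons w (thead w)].
have inj_close : injective close.
  by move=> w w' /(congr1 val) /= /rcons_inj[/val_inj].
have sub_close : close @: [set: string d k.+1] \subset ~: distinct_ends d k.+2.
  apply/subsetP => _ /imsetP[w _ ->]; rewrite inE (distinct_endsE _ _ (thead w)).
  case/tupleP: w => a t; rewrite last_rcons theadE.
  by rewrite negbK.
have := subset_leq_card sub_close.
rewrite card_imset // cardsT card_tuple card_ord => le_compl.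
rewrite mulnBl mul1n -expnS leq_subRL; last by rewrite leq_pexp2l.
rewrite -[d in d ^ k.+2]card_ord -card_tuple -(cardsC (distinct_ends d k.+2)).
by rewrite addnC leq_add2l.
Qed.

Lemma exists_notin_pair (d : nat) (a b : 'I_d) :
  2 < d -> exists c, (c != a) && (c != b).
Proof.
move=> d_gt2; have : 0 < #|~: [set a; b]|.
  rewrite cardsCs setCK card_ord subn_gt0.
  by apply: leq_ltn_trans d_gt2; rewrite cards2; case: eqP.
by case/card_gt0P => c; rewrite !inE negb_or; exists c.
Qed.

Lemma exists_neq (d : nat) (a : 'I_d) : 1 < d -> exists c, c != a.
Proof.
move=> d_gt1; have : 0 < #|~: [set a]|.
  by rewrite cardsCs setCK card_ord cards1 subn_gt0.
by case/card_gt0P => c; rewrite !inE; exists c.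
Qed.

Lemma last_tupleS (T : Type) (k : nat) (a b : T) (w : k.+1.-tuple T) :
  last a w = last b w.
Proof. by case/tupleP: w. Qed.

Lemma distinct_ends_identifying (d k : nat) :
  1 < d -> odd k.+2 \/ 2 < d ->
  identifying_code (debruijn d k.+2) 1 (distinct_ends d k.+2).
Proof.
(* The letter [x0] is only a default for [head] and [last], which are applied to nonempty words. *)
move=> d_gt1 odd_or; pose x0 := Ordinal (ltnW d_gt1).
have consS a (w : string d k.+1) : a != last x0 w ->
    [tuple of a :: w] \in distinct_ends d k.+2.
  by rewrite cons_in_distinct_ends (last_tupleS _ _ a x0).
split=> [v|u v].
  have [w [b ->]] := rcons_tupleP _ _ v.
  have [a a_neq] := exists_neq _ (last x0 w) d_gt1.
  apply/set0Pn; exists [tuple of a :: w].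
  by rewrite in_ID1 debruijn_cons_rcons eqxx orbT consS.
have [w [b ->]] := rcons_tupleP _ _ u; have [w' [b' ->]] := rcons_tupleP _ _ v.
have [<-{w'} neq_uv|neq_w _] := eqVneq w w'.
  (* Otherwise there is an arc from [w ⊕ c] to [w ⊕ c']. Then [w] is unchanged by deleting its first
     letter and appending [c], so all its letters are [c] and [w ⊕ c] has equal ends. *)
  have not_both c c' : c != c' -> [tuple of rcons w c] \in distinct_ends d k.+2 ->
      ID (debruijn d k.+2) 1 (distinct_ends d k.+2) [tuple of rcons w c] !=
      ID (debruijn d k.+2) 1 (distinct_ends d k.+2) [tuple of rcons w c'].
    move=> neq_c Sc; apply/eqP => /setP/(_ [tuple of rcons w c]).
    rewrite !in_ID1 eqxx Sc /= andbT => /esym/orP[/eqP/(congr1 val)/=|].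
      by move/rcons_inj => [] /eqP; rewrite (negPf neq_c).
    rewrite /debruijn /= -cats1 -[in X in _ == X]cats1 take_size_cat ?size_tuple //.
    move=> /eqP Ew.
    have const (s : seq 'I_d) y : drop 1 (rcons (y :: s) c) = y :: s -> c = y.
      rewrite /= drop0; elim: s y => [|z s IH] y /=; first by case.
      by case=> <- /IH.
    move: Sc Ew; case/tupleP: w {neq_uv} => y s.
    rewrite (distinct_endsE _ _ x0) last_rcons /= cats1 => neq_yc Ew.
    by move/const: Ew neq_yc => ->; rewrite eqxx.
  have neq_b : b != b' by apply: contraNneq neq_uv => ->.
  have [Sb|] := boolP ([tuple of rcons w b] \in distinct_ends d k.+2).
    exact: not_both.
  have [Sb' _|] := boolP ([tuple of rcons w b'] \in distinct_ends d k.+2).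
    by rewrite eq_sym not_both // eq_sym.
  (* With both strings omitted, [b] and [b'] are the first letter of [w]. *)
  rewrite !(distinct_endsE _ _ x0) !negbK !last_rcons.
  move=> /eqP Eb /eqP Eb'; case/negP: neq_b; apply/eqP.
  by rewrite -Eb -Eb'; case/tupleP: (w).
apply/eqP => eqID.
have forced a : a != last x0 w -> [tuple of a :: w] = [tuple of rcons w' b'].
  move=> /consS Sa; move/setP/(_ [tuple of a :: w]): eqID.
  rewrite !in_ID1 !debruijn_cons_rcons eqxx orbT Sa !andbT => /esym.
  by rewrite (negPf neq_w) orbF => /eqP.
have forced' a : a != last x0 w' -> [tuple of a :: w'] = [tuple of rcons w b].
  move=> /consS Sa; move/setP/(_ [tuple of a :: w']): eqID.
  rewrite !in_ID1 !debruijn_cons_rcons eqxx orbT Sa !andbT.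
  by rewrite eq_sym in neq_w; rewrite (negPf neq_w) orbF => /eqP.
case: odd_or => [odd_n|d_gt2].
  have [a a_neq] := exists_neq _ (last x0 w) d_gt1.
  have [a' a'_neq] := exists_neq _ (last x0 w') d_gt1.
  have /(congr1 val)/esym Ev := forced _ a_neq.
  have /(congr1 val)/esym Eu := forced' _ a'_neq.
  (* The length [k.+1] of [w] is even, so [w] ends in [a], against the choice of [a]. *)
  have := last_alternating _ _ _ _ _ _ _ Eu Ev.
  rewrite size_tuple -[odd k.+1]negbK -/(odd k.+2) odd_n /= => last_w.
  by rewrite (last_tupleS _ _ _ a) last_w eqxx in a_neq.
(* A third letter allows [a] to differ also from the first letter of [v], so that [a ⊕ w] cannot be
   [v]. *)
have [a /andP[a_neq1 a_neq2]] :=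
  exists_notin_pair _ (last x0 w) (head x0 (rcons w' b')) d_gt2.
by move/(congr1 (head x0 \o val)): (forced _ a_neq1) => /= Ea; rewrite -Ea eqxx in a_neq2.
Qed.

Theorem theorem3p14 (d n : nat) (hd : 2 <= d) (hn : 2 <= n)
    (hdn : odd n \/ (~~ odd n /\ 2 < d)) :
  [/\ identifying_code (debruijn d n) 1 (distinct_ends d n),
      #|distinct_ends d n| = (d - 1) * d ^ (n - 1)
    & forall S : {set string d n},
        identifying_code (debruijn d n) 1 S -> (d - 1) * d ^ (n - 1) <= #|S| ].
Proof.
case: n hn hdn => [|[|k]] // _ hdn; rewrite [k.+2 - 1]subn1 /=.
have code : identifying_code (debruijn d k.+2) 1 (distinct_ends d k.+2).
  by apply: distinct_ends_identifying => //; case: hdn => [|[_]]; [left|right].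
split=> //; last exact: card_code_lower_bound.
by apply/eqP; rewrite eqn_leq card_distinct_ends_upper_bound ?card_code_lower_bound // ltnW.
Qed.
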